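(* Let $\mathcal{H}$ be a real Hilbert space and let $F_1,\dots,F_n\colon\mathcal{H}\rightrightarrows\mathcal{H}$ be maximally monotone operators with $\mathrm{zer}\left(\sum_{i=1}^nF_i\right)\neq\emptyset$. Let $M\in\mathbb{R}^{m\times n}$, $S\in\mathbb{R}^{n\times m}$ and $N\in\mathbb{R}^{n\times n}$ be matrices satisfying: (i) $\ker M\subseteq\mathbb{R}e$, where $e=(1,\dots,1)^T\in\mathbb{R}^n$; (ii) $\sum_{i,j=1}^nN_{ij}=n$ and $N$ is lower triangular with zeros on the diagonal; (iii) $S^*=-M$; (iv) $M^*M+N+N^*-2\,\mathrm{Id}\preceq 0$. Let $\gamma\in(0,1)$, and let $T\colon\mathcal{H}^m\to\mathcal{H}^m$ be the operator $T(\mathbf{z})=\mathbf{z}+\gamma\mathbf{M}\mathbf{x}$, where $\mathbf{x}\in\mathcal{H}^n$ is determined by $\mathbf{x}=J_{\mathbf{F}}(\mathbf{S}\mathbf{z}+\mathbf{N}\mathbf{x})$. Let $\mathbf{z}^0\in\mathcal{H}^m$ and define the sequences $(\mathbf{z}^k)$ and $(\mathbf{x}^k)$ according to $$\mathbf{z}^{k+1}=T(\mathbf{z}^k)=\mathbf{z}^k+\gamma\mathbf{M}\mathbf{x}^k,\qquad \mathbf{x}^k=J_{\mathbf{F}}(\mathbf{S}\mathbf{z}^k+\mathbf{N}\mathbf{x}^k).$$ Then the following assertions hold. (a) As $k\to\infty$, we have $\mathbf{z}^k-\mathbf{z}^{k+1}\to 0$ and $\sum_{i=1}^ns_ix_i^k\to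 0$ for all $s\in\mathbb{R}^n$ with $\sum_{i=1}^ns_i=0$. (b) The sequence $(\mathbf{z}^k)$ converges weakly to a point $\bar{\mathbf{z}}\in\mathrm{Fix}\,T$. (c) The sequence $(\mathbf{x}^k)$ converges weakly to a point $(\bar{x},\dots,\bar{x})\in\mathcal{H}^n$ such that $\bar{x}\in\mathrm{zer}\left(\sum_{i=1}^nF_i\right)$.
   Context: For a matrix $W=(w_{ij})\in\mathbb{R}^{p\times l}$, the bold symbol $\mathbf{W}:=W\otimes\mathrm{Id}$ denotes the bounded linear operator $\mathcal{H}^l\to\mathcal{H}^p$ given by $(\mathbf{W}\mathbf{x})_i=\sum_{j=1}^l w_{ij}x_j$. The star denotes the adjoint (transpose, for real matrices), and $A\preceq 0$ means that the symmetric matrix $A$ is negative semidefinite. Powers $\mathcal{H}^m$, $\mathcal{H}^n$ carry the product Hilbert space structure. For a maximally monotone operator $F\colon\mathcal{H}\rightrightarrows\mathcal{H}$, the resolvent is $J_F:=(\mathrm{Id}+F)^{-1}$, which is single-valued with full domain. For $\mathbf{x}=(x_1,\dots,x_n)\in\mathcal{H}^n$, $\mathbf{F}(\mathbf{x}):=F_1(x_1)\times\dots\times F_n(x_n)$, and $J_{\mathbf{F}}(\mathbf{x})=(J_{F_1}(x_1),\dots,J_{F_n}(x_n))$. Since $N$ is lower triangular with zeros on the diagonal, the equation $\mathbf{x}=J_{\mathbf{F}}(\mathbf{S}\mathbf{z}+\mathbf{N}\mathbf{x})$ has exactly one solution $\mathbf{x}$ for each $\mathbf{z}$ (computed successively for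 $i=1,\dots,n$). $\mathrm{zer}\left(\sum_{i=1}^nF_i\right):=\{x\in\mathcal{H}: 0\in\sum_{i=1}^nF_i(x)\}$ (Minkowski sum of sets) and $\mathrm{Fix}\,T:=\{\mathbf{z}: T(\mathbf{z})=\mathbf{z}\}$. The symbol $\to$ denotes strong (norm) convergence. The components of $\mathbf{x}^k$ are written $\mathbf{x}^k=(x_1^k,\dots,x_n^k)$. *)

(* Defs.v *)
From HB Require Import structures.
From mathcomp Require Import all_boot all_order all_algebra.
From mathcomp Require Import all_classical all_reals all_analysis.
From mathcomp Require Import ring.

Set Implicit Arguments.
Unset Strict Implicit.
Unset Printing Implicit Defensive.

Import Order.TTheory GRing.Theory Num.Theory.
Import numFieldNormedType.Exports.

Local Open Scope classical_set_scope.
Local Open Scope ring_scope.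

HB.mixin Record CompleteNormedModule_isHilbert (R : realType) H
    & CompleteNormedModule R H := {
  inner : H -> H -> R ;
  innerC : forall x y, inner x y = inner y x ;
  innerDl : forall x y z, inner (x + y) z = inner x z + inner y z ;
  innerZl : forall a x y, inner (a *: x) y = a * inner x y ;
  inner_normE : forall x, inner x x = `|x| ^+ 2
}.

#[short(type="hilbertType")]
HB.structure Definition Hilbert (R : realType) :=
  {H of CompleteNormedModule R H & CompleteNormedModule_isHilbert R H}.

(* The power H^n with its product Hilbert structure,                          *)
(* <x, y> = \sum_i <x_i, y_i>.                                                *)
Definition hpow (R : realType) (H : hilbertType R) (n : nat) :=
  {ffun 'I_n -> H}.

HB.instance Definition _ (R : realType) (H : hilbertType R) (n : nat) :=
  GRing.Lmodule.copy (hpow H n) {ffun 'I_n -> H}.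

Section HilbertPower.
Context (R : realType) (H : hilbertType R) (n : nat).
Implicit Types (x y z : hpow H n) (a : R).

Definition hpow_inner x y : R := \sum_i inner (x i) (y i).
Definition hpow_norm x : R := Num.sqrt (hpow_inner x x).

Lemma hpow_innerC x y : hpow_inner x y = hpow_inner y x.
Proof. by apply: eq_bigr => i _; rewrite innerC. Qed.

Lemma hpow_innerDl x y z :
  hpow_inner (x + y) z = hpow_inner x z + hpow_inner y z.
Proof. by rewrite -big_split; apply: eq_bigr => i _; rewrite ffunE innerDl. Qed.

Lemma hpow_innerZl a x y : hpow_inner (a *: x) y = a * hpow_inner x y.
Proof. by rewrite mulr_sumr; apply: eq_bigr => i _; rewrite ffunE innerZl. Qed.

Lemma hpow_inner_ge0 x : 0 <= hpow_inner x x.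
Proof. by apply: sumr_ge0 => i _; rewrite inner_normE sqr_ge0. Qed.

Lemma hpow_norm_sqr x : hpow_norm x ^+ 2 = hpow_inner x x.
Proof. by rewrite sqr_sqrtr// hpow_inner_ge0. Qed.

Lemma hpow_norm_ge_comp x i : `|x i| <= hpow_norm x.
Proof.
rewrite -ler_sqr ?nnegrE ?sqrtr_ge0// hpow_norm_sqr -inner_normE.
rewrite /hpow_inner (bigD1 i)//= lerDl.
by apply: sumr_ge0 => j _; rewrite inner_normE sqr_ge0.
Qed.

Lemma hpow_norm_le_sum x : hpow_norm x <= \sum_i `|x i|.
Proof.
have s0 : 0 <= \sum_i `|x i| by apply: sumr_ge0.
rewrite -ler_sqr ?nnegrE ?sqrtr_ge0// hpow_norm_sqr [leRHS]expr2 mulr_suml.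
apply: ler_sum => i _; rewrite inner_normE expr2 ler_wpM2l//.
by rewrite (bigD1 i)//= lerDl sumr_ge0.
Qed.

Lemma hpow_norm_eq0 x : hpow_norm x = 0 -> x = 0.
Proof.
move=> x0; apply/ffunP => i; rewrite ffunE; apply/eqP.
by rewrite -normr_le0 -x0 hpow_norm_ge_comp.
Qed.

Lemma hpow_normZ a x : hpow_norm (a *: x) = `|a| * hpow_norm x.
Proof.
rewrite /hpow_norm hpow_innerZl hpow_innerC hpow_innerZl mulrA -expr2.
by rewrite sqrtrM ?sqr_ge0// sqrtr_sqr.
Qed.

Lemma hpow_CS x y : hpow_inner x y <= hpow_norm x * hpow_norm y.
Proof.
have [y0|yN0] := eqVneq (hpow_norm y) 0.
  rewrite y0 mulr0 hpow_innerC (hpow_norm_eq0 y0) -(scale0r 0) hpow_innerZl.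
  by rewrite mul0r.
have ygt : 0 < hpow_inner y y.
  by rewrite -hpow_norm_sqr exprn_gt0// lt_neqAle eq_sym yN0 sqrtr_ge0.
rewrite -[leRHS](ger0_norm _) ?mulr_ge0 ?sqrtr_ge0//.
apply: le_trans (ler_norm _) _.
rewrite -ler_sqr ?nnegrE// !real_normK ?num_real// exprMn !hpow_norm_sqr.
set a := hpow_inner y y; set b := hpow_inner x y.
have := hpow_inner_ge0 (a *: x + (- b) *: y).
rewrite !(hpow_innerDl, hpow_innerZl) !(hpow_innerC _ (_ + _)).
rewrite !(hpow_innerDl, hpow_innerZl) -/a (hpow_innerC y x) -/b.
set c := hpow_inner x x.
have -> : a * (a * c + - b * b) + - b * (a * b + - b * a) = a * (c * a - b ^+ 2).
  by ring.
by rewrite pmulr_rge0// subr_ge0.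
Qed.

Lemma hpow_ler_normD x y : hpow_norm (x + y) <= hpow_norm x + hpow_norm y.
Proof.
rewrite -ler_sqr ?nnegrE ?addr_ge0 ?sqrtr_ge0// sqrrD !hpow_norm_sqr.
rewrite hpow_innerDl !(hpow_innerC _ (_ + _)) !hpow_innerDl (hpow_innerC y x).
rewrite addrA lerD2r -addrA lerD2l -mulr2n.
by rewrite lerMn2r hpow_CS orbT.
Qed.

HB.instance Definition _ := Lmodule_isNormed.Build R (hpow H n)
  hpow_ler_normD hpow_normZ hpow_norm_eq0.

Lemma hpow_normE x : `|x| = hpow_norm x. Proof. by []. Qed.

Lemma hpow_complete (F : set_system (hpow H n)) :
  ProperFilter F -> cauchy F -> cvg F.
Proof.
move=> FF /cauchyP Fc; apply/cvg_ex.
have cvgi i : cvg ((fun x : hpow H n => x i) @ F).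
  apply: cauchy_cvg; apply/cauchyP => e e0.
  have [x Fx] := Fc e e0; exists (x i); rewrite /fmap/=.
  apply: filterS Fx => y; rewrite -!ball_normE /=; apply: le_lt_trans.
  by have := hpow_norm_ge_comp (x - y) i; rewrite !ffunE.
exists [ffun i => lim ((fun x : hpow H n => x i) @ F)].
apply/cvgrPdist_lt => e e0.
have e' : 0 < e / n.+1%:R by rewrite divr_gt0// ltr0n.
have : F [set x : hpow H n | forall i,
    `|lim ((fun x : hpow H n => x i) @ F) - x i| < e / n.+1%:R].
  by apply: filter_forall => i; have /cvgrPdist_lt/(_ _ e') := cvgi i.
apply: filterS => x xe; rewrite hpow_normE.
apply: le_lt_trans (hpow_norm_le_sum _) _.
apply: (@le_lt_trans _ _ (\sum_(i < n) e / n.+1%:R)).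
  by apply: ler_sum => i _; rewrite !ffunE ltW.
rewrite sumr_const card_ord -[ltLHS]mulr_natr -mulrA gtr_pMr// mulrC.
by rewrite ltr_pdivrMr ?ltr0n// mul1r ltr_nat.
Qed.

HB.instance Definition _ := Uniform_isComplete.Build (hpow H n) hpow_complete.

Lemma hpow_inner_normE x : hpow_inner x x = `|x| ^+ 2.
Proof. by rewrite hpow_normE hpow_norm_sqr. Qed.

HB.instance Definition _ := CompleteNormedModule_isHilbert.Build R (hpow H n)
  hpow_innerC hpow_innerDl hpow_innerZl hpow_inner_normE.

End HilbertPower.

Definition weak_cvg (R : realType) (H : hilbertType R) (u : nat -> H) (l : H) :=
  forall y : H, inner (u k) y @[k --> \oo] --> inner l y.

Section Operators.
Context (R : realType) (H : hilbertType R).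
Implicit Types (A B : H -> set H).

Definition monotone_op A := forall x y u v,
  A x u -> A y v -> 0 <= inner (x - y) (u - v).

Definition maximally_monotone A := monotone_op A /\
  forall B, monotone_op B -> (forall x, A x `<=` B x) -> B = A.

Definition zer A : set H := [set x | A x 0].

(* (Id + A)^-1 as a set-valued map.  For A maximally monotone, every          *)
(* resolvent A y is a singleton by Minty's theorem, so that x = J_A(y) reads  *)
(* resolvent A y x.                                                           *)
Definition resolvent A : H -> set H :=
  fun y => [set x | [set x + u | u in A x] y].

(* Minkowski sum of the F_i x. *)
Definition sum_op (n : nat) (F : 'I_n -> H -> set H) : H -> set H := fun x =>
  [set \sum_i u i | u in [set u : 'I_n -> H | forall i, F i x (u i)]].

Definition prod_op (n : nat) (F : 'I_n -> H -> set H) :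
    hpow H n -> set (hpow H n) :=
  fun x => [set u : hpow H n | forall i, F i (x i) (u i)].

(* W \otimes Id *)
Definition mxop (p l : nat) (W : 'M[R]_(p, l)) (x : hpow H l) : hpow H p :=
  [ffun i => \sum_j W i j *: x j].

(* The x such that x = J_F(S z + N x), where J_F = (J_(F_1), ..., J_(F_n)). *)
Definition splitting_point (m n : nat) (F : 'I_n -> H -> set H)
    (S : 'M[R]_(n, m)) (N : 'M[R]_n) (z : hpow H m) : set (hpow H n) :=
  [set x | prod_op (fun i => resolvent (F i)) (mxop S z + mxop N x) x].

(* For F_i maximally monotone and N strictly lower triangular there is        *)
(* exactly one splitting point, hence the default value 0 is never used.      *)
Definition splitting_op (m n : nat) (F : 'I_n -> H -> set H)
    (M : 'M[R]_(m, n)) (S : 'M[R]_(n, m)) (N : 'M[R]_n) (gamma : R)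
    (z : hpow H m) : hpow H m :=
  z + gamma *: mxop M (xget 0 (splitting_point F S N z)).

End Operators.

Definition Fix (X : Type) (T : X -> X) : set X := [set z | T z = z].

Definition negative_semidefinite (R : realType) (n : nat) (A : 'M[R]_n) :=
  A^T = A /\ forall v : 'cV[R]_n, (v^T *m A *m v) 0 0 <= 0.

(* Main.v *)
Require Import Defs.
From mathcomp Require Import all_boot all_order all_algebra.
From mathcomp Require Import all_classical all_reals all_analysis.
From mathcomp Require Import ring lra.
Import Order.TTheory GRing.Theory Num.Theory.
Import numFieldNormedType.Exports.
Local Open Scope classical_set_scope.
Local Open Scope ring_scope.

(** Write [r = S z + N x - x] for the residual of a pair [(z, x)]; then [x] is
    the splitting point of [z] exactly when [r] lies in the product operator at
    [x].  Everything rests on one identity.  The matrix in (iv) is negative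
    semidefinite, so it is [- C^T C] for some [C], and since [S^T = - M],
      [<x, r> = - <M x, z> - (|C x|^2 + |M x|^2) / 2]
    ([residual_energy]).  Testing (iv) on [e = (1, ..., 1)], where the entries
    of [N] sum to [n], gives [|M e|^2 + |C e|^2 = 0]: hence the kernel of [M] is
    the diagonal, and any matrix killing [e], among them [C], factors through
    [M] ([factor_through]).

    _Asymptotics._  Dually the range of [S] consists of the vectors of zero sum,
    so every zero of the sum of the operators is the common value of some
    diagonal splitting point ([zer_splitting_point]).  For such a reference
    pair, monotonicity and the identity give
      [|z^(k+1) - z'|^2 <= |z^k - z'|^2 - gamma (1 - gamma) |M x^k|^2]
    ([fejer_step]).  So [|z^k - z'|] converges and [M x^k] tends to 0, and with
    it [A x^k] for every matrix [A] killing [e]; this is (a).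

    _Weak cluster points._  The sequences are bounded, those [x^k] because a
    splitting point is a Lipschitz function of [z] ([N] is strictly lower
    triangular).  Along an ultrafilter every bounded sequence has a weak limit,
    by compactness of segments of the line and the Riesz representation theorem
    ([bounded_weak_limit]).  If [(z^k, x^k)] has weak limit [(z', x')] then
    [M x' = 0], so [x'] is diagonal; the identity shows that [<x^k, r^k>] tends
    to 0, which is [<x', r'>], so that monotonicity passes to the limit and
    maximality puts [r'] in the product operator at [x']
    ([splitting_point_demiclosed]).  The components of [r'] sum to 0, so the
    common value of [x'] is a zero of the sum.

    _Uniqueness._  By the Fejer inequality [|z^k - z'|] converges for each weak
    cluster point [z'], and Opial's argument ([opial]) allows only one; [x'] is
    determined by [z'].  A sequence with the same weak limit along all
    nonprincipal ultrafilters converges weakly ([weak_limit_ultra]), which gives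
    (b) and (c). *)

Set Implicit Arguments.
Unset Strict Implicit.
Unset Printing Implicit Defensive.

(** * Inner products and Riesz representation *)

Section InnerProduct.
Context (R : realType) (H : hilbertType R).
Implicit Types (x y z : H) (a : R).

Lemma innerDr x y z : inner x (y + z) = inner x y + inner x z.
Proof. by rewrite innerC innerDl !(innerC _ x). Qed.

Lemma innerZr a x y : inner x (a *: y) = a * inner x y.
Proof. by rewrite innerC innerZl innerC. Qed.

Lemma inner0l x : inner 0 x = 0.
Proof. by rewrite -(scale0r 0) innerZl mul0r. Qed.

Lemma inner0r x : inner x 0 = 0.
Proof. by rewrite innerC inner0l. Qed.

Lemma innerNl x y : inner (- x) y = - inner x y.
Proof. by rewrite -scaleN1r innerZl mulN1r. Qed.

Lemma innerNr x y : inner x (- y) = - inner x y.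
Proof. by rewrite innerC innerNl innerC. Qed.

Lemma innerBl x y z : inner (x - y) z = inner x z - inner y z.
Proof. by rewrite innerDl innerNl. Qed.

Lemma innerBr x y z : inner x (y - z) = inner x y - inner x z.
Proof. by rewrite innerDr innerNr. Qed.

Lemma inner_suml (I : finType) (u : I -> H) y :
  inner (\sum_i u i) y = \sum_i inner (u i) y.
Proof.
by elim/big_rec2: _ => [|i a b _ <-]; rewrite ?inner0l ?innerDl.
Qed.

Lemma normD_sqr x y : `|x + y| ^+ 2 = `|x| ^+ 2 + 2 * inner x y + `|y| ^+ 2.
Proof. by rewrite -!inner_normE innerDl !innerDr (innerC y x); ring. Qed.

Lemma inner_le_norm x y : inner x y <= `|x| * `|y|.
Proof.
have [->|x0] := eqVneq x 0; first by rewrite inner0l normr0 mul0r.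
have [->|y0] := eqVneq y 0; first by rewrite inner0r normr0 mulr0.
have xgt : 0 < `|x| by rewrite normr_gt0.
have ygt : 0 < `|y| by rewrite normr_gt0.
have : 0 <= `| `|y| *: x + (- `|x|) *: y| ^+ 2 by rewrite sqr_ge0.
rewrite normD_sqr !normrZ innerZl innerZr normrN !normr_id.
have -> : (`|y| * `|x|) ^+ 2 + 2 * (`|y| * (- `|x| * inner x y)) +
  (`|x| * `|y|) ^+ 2 = (2 * (`|x| * `|y|)) * (`|x| * `|y| - inner x y) by ring.
by rewrite pmulr_rge0 ?subr_ge0// mulr_gt0// mulr_gt0.
Qed.

Lemma CauchySchwarz x y : `|inner x y| <= `|x| * `|y|.
Proof.
rewrite ler_norml inner_le_norm andbT lerNl -innerNl.
by rewrite -(normrN x) inner_le_norm.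
Qed.

Lemma inner_inj x y : (forall h, inner x h = inner y h) -> x = y.
Proof.
move=> xy; apply/eqP; rewrite -subr_eq0 -normr_eq0 -sqrf_eq0 -inner_normE.
by rewrite innerBl xy subrr.
Qed.

Lemma inner_cvg0 (T : Type) (U : set_system T) {FU : Filter U} (u v : T -> H)
    (c : R) : u @ U --> (0 : H) -> (forall k, `|v k| <= c) ->
  inner (u k) (v k) @[k --> U] --> (0 : R).
Proof.
move=> u0 vc; apply/norm_cvg0P.
apply: (@squeeze_cvgr _ _ _ _ (fun=> 0) (fun k => `|u k| * c)).
- apply: nearW => k; rewrite normr_ge0/=; apply: le_trans (CauchySchwarz _ _) _.
  by rewrite ler_wpM2l.
- exact: cvg_cst.
- rewrite -(mul0r c); apply: cvgMr_tmp.
  by rewrite -(normr0 H); apply: cvg_norm.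
Qed.

Lemma cvg_inner (T : Type) (U : set_system T) {FU : Filter U} (u : T -> H) l y :
  u @ U --> l -> inner (u k) y @[k --> U] --> inner l y.
Proof.
move=> /(subr_cvg0 u l).2 ul; apply/subr_cvg0.
under eq_cvg do rewrite -innerBl.
exact: (inner_cvg0 ul (fun=> lexx `|y|)).
Qed.

(** The representing vector minimizes [J x = |x|^2 - 2 f x].  By the parallelogram
    identity minimizing sequences of the strictly convex [J] are Cauchy, and the
    first-order condition at the limit is the representation. *)
Lemma riesz_representation (f : H -> R) (c : R) :
  (forall x y, f (x + y) = f x + f y) -> (forall a x, f (a *: x) = a * f x) ->
  (forall x, `|f x| <= c * `|x|) -> exists l, forall y, f y = inner l y.
Proof.
move=> fD fZ fc; pose J x := `|x| ^+ 2 - 2 * f x; pose E := range J.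
have infE : has_inf E.
  split; first by exists (J 0), 0.
  exists (- c ^+ 2) => _ [x _ <-]; rewrite /J.
  have : f x <= c * `|x| := le_trans (ler_norm _) (fc x).
  have := sqr_ge0 (`|x| - c); nra.
have Jinf x : inf E <= J x by apply: ge_inf; [exact: infE.2 | exists x].
have harm k : (0 : R) < k.+1%:R^-1 by rewrite invr_gt0 ltr0n.
have /choice[u uE] : forall k : nat, exists x, J x < inf E + k.+1%:R^-1.
  move=> k; have [_ [x _ <-] Jx] := inf_adherent (harm k) infE.
  by exists x.
have udist k p : `|u k - u p| ^+ 2 <= 2 * (k.+1%:R^-1 + p.+1%:R^-1).
  have := Jinf (2^-1 *: (u k + u p)); have := uE k; have := uE p.
  rewrite /J fZ fD normrZ exprMn (normD_sqr (u k) (u p)) ger0_norm ?invr_ge0//.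
  rewrite (normD_sqr (u k) (- u p)) innerNr normrN.
  have -> : 2^-1 ^+ 2 = 4^-1 :> R by field.
  move: k.+1%:R^-1 p.+1%:R^-1 => a b; lra.
have : cvgn u.
  apply: cauchy_cvg; apply: cauchy_exP => e e0.
  have e2 : 0 < e ^+ 2 / 4 by rewrite divr_gt0 ?exprn_gt0.
  have [p _ pe] := near_infty_natSinv_lt (PosNum e2).
  exists (u p); exists p => // k /= pk; rewrite -ball_normE/=.
  rewrite -ltr_sqr ?nnegrE ?normr_ge0 ?(ltW e0)//.
  have := udist p k; have := pe k pk; have := pe p (leqnn p) => /=.
  move: k.+1%:R^-1 p.+1%:R^-1 => a b; lra.
move=> /cvg_ex[l ul]; exists l => h; apply/eqP; rewrite -subr_eq0; apply/eqP.
have uh : inner (u k) h @[k --> \oo] --> inner l h by exact: cvg_inner.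
have quad t : 0 <= t ^+ 2 * `|h| ^+ 2 + 2 * t * (inner l h - f h).
  have cv : t ^+ 2 * `|h| ^+ 2 + 2 * t * (inner (u k) h - f h) + k.+1%:R^-1
     @[k --> \oo] --> t ^+ 2 * `|h| ^+ 2 + 2 * t * (inner l h - f h) + 0.
    apply: cvgD; last exact: cvg_harmonic.
    apply: cvgD; first exact: cvg_cst.
    by apply: cvgMl_tmp; apply: cvgB => //; exact: cvg_cst.
  rewrite -[leRHS]addr0 -(cvg_lim _ cv)//.
  apply: limr_ge; first by apply/cvg_ex; eexists; exact: cv.
  apply: nearW => k; have := Jinf (u k + t *: h); have := uE k.
  move: k.+1%:R^-1 => a.
  rewrite /J fD fZ normD_sqr innerZr normrZ exprMn real_normK ?num_real//; nra.
set d := inner l h - f h in quad.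
have [h0|h0] := eqVneq h 0.
  by rewrite h0 inner0r subr0 -(scale0r 0) fZ mul0r.
have hgt : 0 < `|h| ^+ 2 by rewrite exprn_gt0// normr_gt0.
have := quad (- d / `|h| ^+ 2).
have -> : (- d / `|h| ^+ 2) ^+ 2 * `|h| ^+ 2 + 2 * (- d / `|h| ^+ 2) * d =
    - (d ^+ 2) / `|h| ^+ 2 
  by field; rewrite normr_eq0.
rewrite pmulr_lge0 ?invr_gt0// oppr_ge0 => d0.
have /eqP : d ^+ 2 == 0 by rewrite eq_le d0 sqr_ge0.
by move/eqP; rewrite sqrf_eq0 => /eqP; rewrite /d => ?; lra.
Qed.

End InnerProduct.

(** * Weak limits along filters *)

Section WeakLimits.

Definition weak_limit (R : realType) (H : hilbertType R) (T : Type)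
    (U : set_system T) (u : T -> H) (l : H) :=
  forall y, inner (u k) y @[k --> U] --> inner l y.

(** The image filter clusters in the compact segment [[- c, c]]; an ultrafilter
    converges to any of its cluster points. *)
Lemma ultra_bounded_cvg (R : realType) (T : Type) (U : set_system T)
    (UU : UltraFilter U) (f : T -> R) (c : R) :
  (forall k, `|f k| <= c) -> cvg (f @ U).
Proof.
move=> fc; have PU := @ultra_proper _ _ UU.
have Uc : (f @ U) `[- c, c]%classic.
  apply: (@filterS _ U _ setT); last exact: filterT.
  by move=> k _ /=; rewrite in_itv/= -ler_norml.
have [l [_ fl]] := @segment_compact R (- c) c (f @ U) _ Uc.
apply/cvg_ex; exists l => B Bl.
have [//|UB] := in_ultra_setVsetC (f @^-1` B) UU.
by have [p [/= Bp nBp]] := fl (~` B) B UB Bl.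
Qed.

Context (R : realType) (H : hilbertType R).

Lemma weak_limit_unique (T : Type) (U : set_system T) {PU : ProperFilter U}
    (u : T -> H) (l l' : H) : weak_limit U u l -> weak_limit U u l' -> l = l'.
Proof.
move=> ul ul'; apply: inner_inj => y.
by rewrite -(cvg_lim _ (ul y))// (cvg_lim _ (ul' y)).
Qed.

(** Along an ultrafilter all the scalar limits of [<u k, y>] exist at once and
    define a bounded linear form in [y], which has a representing vector. *)
Lemma bounded_weak_limit (T : Type) (U : set_system T) (UU : UltraFilter U)
    (u : T -> H) (c : R) :
  (forall k, `|u k| <= c) -> exists l, weak_limit U u l.
Proof.
move=> uc; have PU := @ultra_proper _ _ UU.
have cv y : cvg (inner (u k) y @[k --> U]).
  apply: (@ultra_bounded_cvg _ _ _ _ _ (c * `|y|)) => k.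
  by apply: le_trans (CauchySchwarz _ _) _; rewrite ler_wpM2r.
pose f y := lim (inner (u k) y @[k --> U]).
have [| | |l fl] := @riesz_representation _ _ f c.
- move=> x y; rewrite /f -limD//; congr (lim (fmap _ U)).
  by apply/funext => k; rewrite innerDr.
- move=> a x; apply: cvg_lim => //; under eq_cvg do rewrite innerZr.
  exact: cvgMl_tmp (cv x).
- move=> x; rewrite /f -lim_norm//; apply: limr_le; first exact: is_cvg_norm.
  apply: nearW => k; apply: le_trans (CauchySchwarz _ _) _.
  by rewrite ler_wpM2r.
by exists l => y; rewrite -fl; exact: cv.
Qed.

Lemma cvg_weak_limit (T : Type) (U : set_system T) {FU : Filter U}
   (u : T -> H) l : u @ U --> l -> weak_limit U u l.
Proof. by move=> ul y; exact: cvg_inner. Qed.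

(** If [<u k, y>] stayed out of a neighbourhood of [<l, y>] on a set that [F] does
    not exclude, an ultrafilter containing [F] and that set would contradict the
    hypothesis. *)
Lemma weak_limit_ultra (T : Type) (F : set_system T) {PF : ProperFilter F}
    (u : T -> H) (l : H) :
  (forall U, UltraFilter U -> F `<=` U -> weak_limit U u l) -> weak_limit F u l.
Proof.
move=> ul y B Bl; apply: contrapT => nFB.
have PG : ProperFilter (within (~` (fun k => inner (u k) y) @^-1` B) F).
  split; last exact: within_filter.
  rewrite /within/= => FB; apply: nFB; apply: filterS FB => k /= kB.
  by apply: contrapT => /kB.
have [U [UU GU]] := ultraFilterLemma PG.
have FU : F `<=` U by move=> A FA; apply: GU; apply: filterS FA.
have UB : U ((fun k => inner (u k) y) @^-1` B) := ul U UU FU y B Bl.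
have UnB : U (~` (fun k => inner (u k) y) @^-1` B).
  by apply: GU; apply: nearW => k.
have PU := @ultra_proper _ _ UU.
by have [k []] := filter_ex (filterI UB UnB).
Qed.

End WeakLimits.

(** * Real matrices: Gram factorization and matrices killing constants *)

Section Matrices.
Context (R : realType).

Lemma affine_ge0_slope (p q : R) : (forall t, 0 <= t * p + q) -> p = 0.
Proof.
move=> h; apply/eqP; apply: contraT => p0.
have := h ((- 1 - q) / p); rewrite divfK//; lra.
Qed.

(** Cholesky factorization, by induction on the size: with
    [B = block_mx b v v^T D] and [r = sqrt b], the first row of [C] is
    [(r, r^-1 v)], and the Schur complement [D - v^T v / b] is again positive
    semidefinite.  When [b = 0] positivity forces [v = 0], so the convention
    [0^-1 = 0] makes the same formula valid. *)
Lemma psd_factor n (B : 'M[R]_n) :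
  B^T = B -> (forall v : 'cV_n, 0 <= (v^T *m B *m v) 0 0) ->
  exists C : 'M[R]_n, B = C^T *m C.
Proof.
have addE (A A' : 'M[R]_1) : (A + A') 0 0 = A 0 0 + A' 0 0 by rewrite mxE.
have scaleE a (A : 'M[R]_1) : (a *: A) 0 0 = a * A 0 0 by rewrite mxE.
have oppE (A : 'M[R]_1) : (- A) 0 0 = - A 0 0 by rewrite mxE.
have scalarE a : (a%:M : 'M[R]_1) 0 0 = a by rewrite mxE eqxx mulr1n.
have trE (A : 'M[R]_1) : A^T 0 0 = A 0 0 by rewrite mxE.
elim: n B => [|n IH] B.
  by exists 0; rewrite [B]flatmx0 mulmx0.
move: B; rewrite -[n.+1]/(1 + n)%N => B Bsym Bpsd.
pose b := ulsubmx B 0 0; pose v := ursubmx B; pose D := drsubmx B.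
have BE : B = block_mx b%:M v v^T D.
  rewrite -[LHS]submxK [ulsubmx B]mx11_scalar; congr block_mx.
  by rewrite /v trmx_ursub Bsym.
have Dsym : D^T = D by rewrite /D trmx_drsub Bsym.
have quad (a : R) (w : 'cV_n) :
    0 <= b * a ^+ 2 + 2 * a * (v *m w) 0 0 + (w^T *m D *m w) 0 0.
  have := Bpsd (col_mx a%:M w).
  rewrite BE tr_col_mx mul_row_block mul_row_col tr_scalar_mx.
  rewrite !mulmxDl -trmx_mul -scalar_mxM !mul_scalar_mx !mul_mx_scalar.
  rewrite -scalemxAl !addE !scaleE scalarE trE.
  set vw := (v *m w) 0 0; set q := (_ *m w) 0 0.
  by have -> : a * b * a + a * vw + (a * vw + q) = b * a ^+ 2 + 2 * a * vw + q by ring.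
have b0 : 0 <= b.
  by have := quad 1 0; rewrite !mulmx0 !mxE mulr0 !addr0 expr1n mulr1.
(* with b = 0 the form is affine in the first coordinate, hence constant in it *)
have v0 : b = 0 -> v = 0.
  move=> bE; apply/rowP => i; rewrite [RHS]mxE.
  have h a := quad a (delta_mx i 0).
  apply: (mulfI (_ : 2 != 0 :> R)); rewrite ?pnatr_eq0// mulr0.
  apply: (@affine_ge0_slope _ (((delta_mx i 0)^T *m D *m delta_mx i 0) 0 0)) => t.
  have := h t; rewrite bE -colE [(col i v) 0 0]mxE mul0r add0r.
  have -> : t * (2 * v 0 i) = 2 * t * v 0 i by ring.
  exact.
have rr : Num.sqrt b * Num.sqrt b = b by rewrite -expr2 sqr_sqrtr.
have rv : Num.sqrt b *: ((Num.sqrt b)^-1 *: v) = v.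
  rewrite scalerA; have [bE|bN0] := eqVneq b 0; first by rewrite v0// scaler0.
  by rewrite divff ?scale1r// sqrtr_eq0 -ltNge lt_neqAle eq_sym bN0.
set r := Num.sqrt b in rr rv; set c := r^-1 *: v in rv.
have [| |C' CE] := IH (D - c^T *m c).
- by rewrite linearB/= trmx_mul trmxK Dsym.
- move=> w; rewrite mulmxBr mulmxBl addE oppE.
  have -> : w^T *m (c^T *m c) *m w = ((c *m w) 0 0 ^+ 2)%:M.
    rewrite mulmxA -trmx_mul -mulmxA [c *m w]mx11_scalar tr_scalar_mx.
    by rewrite -scalar_mxM scalarE expr2.
  have vw : (v *m w) 0 0 = r * (c *m w) 0 0 by rewrite -{1}rv -scalemxAl scaleE.
  have [bE|bN0] := eqVneq b 0.
    have := quad 0 w; rewrite /c (v0 bE) scaler0 mul0mx !mxE.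
    by rewrite expr0n !mulr0 !mul0rn !add0r subr0.
  have rN0 : r != 0 by apply: contraNneq bN0 => r0; rewrite -rr r0 mul0r.
  (* the first coordinate that minimizes the form *)
  have := quad (- (c *m w) 0 0 / r) w; rewrite vw -rr scalarE.
  set q := (_ *m w) 0 0; set x := (c *m w) 0 0.
  have -> // : r * r * (- x / r) ^+ 2 + 2 * (- x / r) * (r * x) + q = q - x ^+ 2.
  by field.
exists (block_mx r%:M c 0 C').
rewrite tr_block_mx mulmx_block trmx0 tr_scalar_mx -CE BE.
rewrite !mul0mx !mulmx0 !addr0 -scalar_mxM rr mul_scalar_mx mul_mx_scalar rv.
by rewrite -linearZ/= rv addrC subrK.
Qed.

(** The columns of [cokermx M] lie in the kernel of [M], so they are constant and
    [A] kills them; this is inclusion of row spaces. *)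
Lemma factor_through (m n p : nat) (M : 'M[R]_(m, n)) (A : 'M[R]_(p, n)) :
  (forall v : 'cV[R]_n, M *m v = 0 -> exists a : R, v = a *: const_mx 1) ->
  A *m (const_mx 1 : 'cV_n) = 0 -> exists P, A = P *m M.
Proof.
move=> kerM Ae; suff /submxP : (A <= M)%MS by [].
rewrite submxE; apply/eqP/matrixP => i j.
have [a aE] : exists a : R, col j (cokermx M) = a *: const_mx 1.
  by apply: kerM; rewrite colE mulmxA mulmx_coker mul0mx.
have <- : col j (A *m cokermx M) i 0 = (A *m cokermx M) i j by rewrite mxE.
by rewrite colE -mulmxA -colE aE -scalemxAr Ae scaler0 !mxE.
Qed.

Lemma mulmx_const1 p n (A : 'M[R]_(p, n)) i :
  (A *m (const_mx 1 : 'cV_n)) i 0 = \sum_j A i j.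
Proof. by rewrite mxE; apply: eq_bigr => j _; rewrite mxE mulr1. Qed.

(** The orthogonal projection of [R^n] onto the vectors of zero sum. *)
Definition centering n : 'M[R]_n := 1%:M - n%:R^-1 *: const_mx 1.

Lemma tr_centering n : (centering n)^T = centering n.
Proof. by apply/matrixP => i j; rewrite !mxE eq_sym. Qed.

Lemma centering_const1 n : centering n *m (const_mx 1 : 'cV_n) = 0.
Proof.
apply/colP => i; have n0 : n%:R != 0 :> R.
  by rewrite pnatr_eq0 -lt0n (leq_ltn_trans _ (ltn_ord i)).
rewrite mulmx_const1 !mxE.
under eq_bigr do rewrite !mxE.
rewrite big_split/= sumrN sumr_const card_ord mulr1 -[_ *+ n]mulr_natr mulVf//.
rewrite (bigD1 i)//= eqxx big1 ?addr0 ?subrr// => j.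
by rewrite eq_sym => /negbTE ->.
Qed.

End Matrices.

(** * Matrices acting on powers of a Hilbert space *)

Section MatrixOperators.
Context (R : realType) (H : hilbertType R).

Lemma mxopE p l (W : 'M[R]_(p, l)) (x : hpow H l) i :
  mxop W x i = \sum_j W i j *: x j.
Proof. by rewrite ffunE. Qed.

Lemma mxopDr p l (W : 'M[R]_(p, l)) (x y : hpow H l) :
  mxop W (x + y) = mxop W x + mxop W y.
Proof.
apply/ffunP => i; rewrite !ffunE -big_split; apply: eq_bigr => j _.
by rewrite ffunE scalerDr.
Qed.

Lemma mxopZr p l (W : 'M[R]_(p, l)) a (x : hpow H l) :
  mxop W (a *: x) = a *: mxop W x.
Proof.
apply/ffunP => i; rewrite !ffunE scaler_sumr; apply: eq_bigr => j _.
by rewrite ffunE !scalerA mulrC.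
Qed.

Lemma mxopNr p l (W : 'M[R]_(p, l)) (x : hpow H l) :
  mxop W (- x) = - mxop W x.
Proof. by rewrite -scaleN1r mxopZr scaleN1r. Qed.

Lemma mxopBr p l (W : 'M[R]_(p, l)) (x y : hpow H l) :
  mxop W (x - y) = mxop W x - mxop W y.
Proof. by rewrite mxopDr mxopNr. Qed.

Lemma mxopDl p l (V W : 'M[R]_(p, l)) (x : hpow H l) :
  mxop (V + W) x = mxop V x + mxop W x.
Proof.
apply/ffunP => i; rewrite !ffunE -big_split; apply: eq_bigr => j _.
by rewrite mxE scalerDl.
Qed.

Lemma mxopNl p l (W : 'M[R]_(p, l)) (x : hpow H l) :
  mxop (- W) x = - mxop W x.
Proof.
apply/ffunP => i; rewrite !ffunE -sumrN; apply: eq_bigr => j _.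
by rewrite mxE scaleNr.
Qed.

Lemma mxop_scalar l a (x : hpow H l) : mxop a%:M x = a *: x.
Proof.
apply/ffunP => i; rewrite !ffunE (bigD1 i)//= mxE eqxx big1 ?addr0// => j ji.
by rewrite mxE eq_sym (negbTE ji) scale0r.
Qed.

Lemma mxopM p l q (V : 'M[R]_(p, l)) (W : 'M[R]_(l, q)) (x : hpow H q) :
  mxop (V *m W) x = mxop V (mxop W x).
Proof.
apply/ffunP => i; rewrite !ffunE.
under [RHS]eq_bigr do rewrite ffunE scaler_sumr.
rewrite exchange_big; apply: eq_bigr => j _.
by rewrite mxE scaler_suml; apply: eq_bigr => k _; rewrite scalerA.
Qed.

Lemma mxop_adjoint p l (W : 'M[R]_(p, l)) (x : hpow H l) (y : hpow H p) :
  inner (mxop W x) y = inner x (mxop W^T y).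
Proof.
rewrite /inner/= /hpow_inner.
under eq_bigr do rewrite ffunE inner_suml.
under [RHS]eq_bigr do rewrite ffunE innerC inner_suml.
rewrite exchange_big; apply: eq_bigr => j _; apply: eq_bigr => i _.
by rewrite !innerZl mxE innerC.
Qed.

Lemma mxop_diag p l (W : 'M[R]_(p, l)) (a : H) i :
  mxop W [ffun=> a] i = (\sum_j W i j) *: a.
Proof.
by rewrite ffunE scaler_suml; apply: eq_bigr => j _; rewrite ffunE.
Qed.

Lemma sum_mxop p l (W : 'M[R]_(p, l)) (x : hpow H l) :
  \sum_i mxop W x i = \sum_j (\sum_i W i j) *: x j.
Proof.
under eq_bigr do rewrite ffunE; rewrite exchange_big; apply: eq_bigr => j _.
by rewrite scaler_suml.
Qed.

Lemma mxop_diag0 p l (W : 'M[R]_(p, l)) (a : H) :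
  W *m (const_mx 1 : 'cV_l) = 0 -> mxop W ([ffun=> a] : hpow H l) = 0.
Proof.
by move=> We; apply/ffunP => i; rewrite mxop_diag -mulmx_const1 We !mxE scale0r ffunE.
Qed.

Lemma mxop_bounded p l (W : 'M[R]_(p, l)) :
  exists2 K : R, 0 <= K & forall x : hpow H l, `|mxop W x| <= K * `|x|.
Proof.
exists (\sum_i \sum_j `|W i j|) => [|x].
  by apply: sumr_ge0 => i _; apply: sumr_ge0.
rewrite mulr_suml hpow_normE; apply: le_trans (hpow_norm_le_sum _) _.
apply: ler_sum => i _; rewrite ffunE mulr_suml.
apply: le_trans (ler_norm_sum _ _ _) _; apply: ler_sum => j _.
by rewrite normrZ ler_wpM2l// hpow_norm_ge_comp.
Qed.

Lemma mxop_cvg0 (T : Type) (U : set_system T) {FU : Filter U} p l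
    (W : 'M[R]_(p, l)) (u : T -> hpow H l) :
  u @ U --> (0 : hpow H l) -> mxop W (u k) @[k --> U] --> (0 : hpow H p).
Proof.
have [K K0 WK] := mxop_bounded W => u0; apply/norm_cvg0P.
apply: (@squeeze_cvgr _ _ _ _ (fun=> 0) (fun k => K * `|u k|)).
- by apply: nearW => k; rewrite normr_ge0 WK.
- exact: cvg_cst.
- by rewrite -(mulr0 K); apply: cvgMl_tmp; rewrite -(normr0 (hpow H l)); apply: cvg_norm.
Qed.

Lemma weak_limit_mxop (T : Type) (U : set_system T) p l
    (W : 'M[R]_(p, l)) (u : T -> hpow H l) (v : hpow H l) :
  weak_limit U u v -> weak_limit U (fun k => mxop W (u k)) (mxop W v).
Proof.
by move=> uv y; under eq_cvg do rewrite mxop_adjoint; rewrite mxop_adjoint; exact: uv.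
Qed.

Lemma mxop_centering n (x : hpow H n) i :
  mxop (centering R n) x i = x i - n%:R^-1 *: \sum_j x j.
Proof.
rewrite mxopDl mxopNl mxop_scalar scale1r !ffunE; congr (_ - _).
by rewrite scaler_sumr; apply: eq_bigr => j _; rewrite !mxE mulr1.
Qed.

(** The hypothesis on the kernel concerns real vectors; it reaches vectors with
    entries in [H] through the centering matrix, which factors through [M]. *)
Lemma mxop_ker_diag m n (M : 'M[R]_(m, n)) (x : hpow H n) :
  (forall v : 'cV[R]_n, M *m v = 0 -> exists a : R, v = a *: const_mx 1) ->
  mxop M x = 0 -> exists a, x = [ffun=> a].
Proof.
move=> kerM Mx; exists (n%:R^-1 *: \sum_j x j); apply/ffunP => i; rewrite ffunE.
have [P PE] := factor_through kerM (@centering_const1 R n).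
apply/eqP; rewrite -subr_eq0 -mxop_centering PE mxopM Mx.
by rewrite -(scale0r 0) mxopZr scale0r ffunE.
Qed.

End MatrixOperators.

(** * Monotone operators *)

Section MonotoneOperators.
Context (R : realType) (H : hilbertType R).

(** Adding the pair [(x, u)] to the graph of [A] keeps it monotone. *)
Lemma maximally_monotone_mem (A : H -> set H) (x u : H) :
  maximally_monotone A ->
  (forall y v, A y v -> 0 <= inner (x - y) (u - v)) -> A x u.
Proof.
move=> [Amon Amax] xu.
rewrite -(Amax (fun a => [set b | A a b \/ (a = x /\ b = u)])); first by right.
- move=> a c b d /= [Aab|[-> ->]] [Acd|[-> ->]].
  + exact: Amon.
  + by rewrite -opprB -(opprB u) innerNl innerNr opprK xu.
  + exact: xu.
  + by rewrite subrr inner0l.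
- by move=> a b; left.
Qed.

(** Maximality of the product operator.  Suppose that [F i] misses
    [(x i, u i)].  Each graph [F j] has a point at which the form
    [<x j - y, u j - v>] is nonpositive: the pair itself if it belongs to the
    graph, a witness of non-monotone relation otherwise, where the form is
    negative.  The sum over [j] is then negative. *)
Lemma prod_op_mem n (F : 'I_n -> H -> set H) (x u : hpow H n) :
  (forall i, maximally_monotone (F i)) ->
  (forall y v, prod_op F y v -> 0 <= inner (x - y) (u - v)) -> prod_op F x u.
Proof.
move=> Fmax xu; have /choice[yv yvP] : forall i, exists p : H * H, [/\ F i p.1 p.2,
    inner (x i - p.1) (u i - p.2) <= 0 &
    ~ F i (x i) (u i) -> inner (x i - p.1) (u i - p.2) < 0].
  move=> i; have [Fxu|nF] := pselect (F i (x i) (u i)).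
    by exists (x i, u i); split => //=; rewrite subrr inner0l.
  apply: contrapT => nyv; apply: nF; apply: maximally_monotone_mem => // y v Fyv.
  rewrite leNgt; apply/negP => lt0; apply: nyv; exists (y, v).
  by split => //; exact: ltW.
move=> i; apply: contrapT => nF.
have [_ _ /(_ nF) lt0] := yvP i.
have /xu : prod_op F [ffun j => (yv j).1] [ffun j => (yv j).2].
  by move=> j; rewrite !ffunE; have [] := yvP j.
rewrite leNgt => /negP; apply.
rewrite /inner/= /hpow_inner (bigD1 i)//= !ffunE.
rewrite -[ltRHS]addr0; apply: ltr_leD => //.
by apply: sumr_le0 => j _; rewrite !ffunE; have [] := yvP j.
Qed.

Lemma prod_op_monotone n (F : 'I_n -> H -> set H) :
  (forall i, monotone_op (F i)) ->
  forall x y u v : hpow H n, prod_op F x u -> prod_op F y v ->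
  0 <= inner (x - y) (u - v).
Proof.
move=> Fmon x y u v Fxu Fyv; apply: sumr_ge0 => i _; rewrite !ffunE.
exact: (Fmon i _ _ _ _ (Fxu i) (Fyv i)).
Qed.

End MonotoneOperators.

(** * Splitting points *)

Section SplittingPoints.
Context (R : realType) (H : hilbertType R) (m n : nat) (F : 'I_n -> H -> set H).
Context (M : 'M[R]_(m, n)) (S : 'M[R]_(n, m)) (N : 'M[R]_n).

Definition splitting_residual (z : hpow H m) (x : hpow H n) : hpow H n :=
  mxop S z + mxop N x - x.

Lemma splitting_residualE z x i :
  splitting_residual z x i = mxop S z i + mxop N x i - x i.
Proof. by rewrite /splitting_residual !ffunE. Qed.

Lemma splitting_pointP z x :
  splitting_point F S N z x <-> prod_op F x (splitting_residual z x).
Proof.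
split=> [h i|h i].
  have [u Fu uE] := h i; rewrite /splitting_residual !ffunE.
  by move: uE; rewrite !ffunE => <-; rewrite addrC addKr.
exists (splitting_residual z x i) => //.
by rewrite !ffunE addrC subrK.
Qed.

Lemma splitting_residualB z z' x x' :
  splitting_residual z x - splitting_residual z' x' =
  splitting_residual (z - z') (x - x').
Proof.
rewrite /splitting_residual !mxopBr !opprD !opprK -!addrA; congr (_ + _).
rewrite [RHS]addrCA; congr (_ + _); rewrite [LHS]addrCA; congr (_ + _).
by rewrite addrCA.
Qed.

(** Resolvents are nonexpansive and the [i]-th one is applied to
    [(S z) i + \sum_(j < i) N i j *: x j], so Lipschitz bounds for the
    components follow by strong induction on [i]. *)
Lemma splitting_point_lipschitz :
  (forall i, monotone_op (F i)) -> (forall i j : 'I_n, (i <= j)%N -> N i j = 0) ->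
  exists2 K, 0 <= K & forall z z' x x',
    splitting_point F S N z x -> splitting_point F S N z' x' ->
    `|x - x'| <= K * `|z - z'|.
Proof.
move=> Fmon trigN; have [KS KS0 KSP] := mxop_bounded H S.
pose lip K (i : 'I_n) := 0 <= K /\ forall z z' x x',
  splitting_point F S N z x -> splitting_point F S N z' x' ->
  `|x i - x' i| <= K * `|z - z'|.
have /choice[K KP] : forall i, exists K, lip K i.
  move=> i; have [p] := ubnP (i : nat); elim: p i => [//|p IH] i ip.
  have /choice[K KP] : forall j : 'I_n, exists K, (j < i)%N -> lip K j.
    move=> j; case: (ltnP j i) => [ji|_]; last by exists 0.
    by have [K KP] := IH j (leq_trans ji ip); exists K.
  exists (KS + \sum_(j < n | (j < i)%N) `|N i j| * K j); split.
    rewrite addr_ge0// sumr_ge0// => j ji.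
    by rewrite mulr_ge0//; have [] := KP j ji.
  move=> z z' x x' /splitting_pointP h /splitting_pointP h'.
  have := Fmon i _ _ _ _ (h i) (h' i).
  have -> : splitting_residual z x i - splitting_residual z' x' i =
     (splitting_residual z x - splitting_residual z' x') i by rewrite !ffunE.
  rewrite splitting_residualB.
  set d := x i - x' i; set w := mxop S (z - z') i + mxop N (x - x') i.
  have -> : splitting_residual (z - z') (x - x') i = w - d by rewrite /w /d !ffunE.
  rewrite innerBr inner_normE subr_ge0 => dw.
  have {}dw : `|d| <= `|w|.
    have [->|d0] := eqVneq d 0; first by rewrite normr0.
    have dgt : 0 < `|d| by rewrite normr_gt0.
    rewrite -(ler_pM2l dgt) -expr2; apply: le_trans dw _; exact: inner_le_norm.
  apply: le_trans dw _; apply: le_trans (ler_normD _ _) _; rewrite mulrDl.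
  apply: lerD.
    by apply: le_trans (KSP _); exact: hpow_norm_ge_comp.
  rewrite mxopE (bigID (fun j : 'I_n => (j < i)%N))/= [X in _ + X]big1 ?addr0.
    rewrite mulr_suml; apply: le_trans (ler_norm_sum _ _ _) _.
    apply: ler_sum => j ji; rewrite normrZ -mulrA ler_wpM2l// !ffunE.
    by have [_] := KP j ji; apply; apply/splitting_pointP.
  by move=> j; rewrite -leqNgt => ij; rewrite trigN// scale0r.
exists (\sum_i K i) => [|z z' x x' h h'].
  by apply: sumr_ge0 => i _; have [] := KP i.
rewrite mulr_suml hpow_normE; apply: le_trans (hpow_norm_le_sum _) _.
by apply: ler_sum => i _; rewrite !ffunE; have [_] := KP i; apply.
Qed.

Lemma splitting_point_unique z x x' :
  (forall i, monotone_op (F i)) -> (forall i j : 'I_n, (i <= j)%N -> N i j = 0) ->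
  splitting_point F S N z x -> splitting_point F S N z x' -> x = x'.
Proof.
move=> Fmon trigN h h'; have [K _ KP] := splitting_point_lipschitz Fmon trigN.
have := KP _ _ _ _ h h'; rewrite subrr normr0 mulr0 normr_le0 subr_eq0.
by move/eqP.
Qed.

Lemma splitting_opE gamma z x :
  (forall i, monotone_op (F i)) -> (forall i j : 'I_n, (i <= j)%N -> N i j = 0) ->
  splitting_point F S N z x ->
  splitting_op F M S N gamma z = z + gamma *: mxop M x.
Proof.
move=> Fmon trigN h; rewrite /splitting_op; congr (_ + _ *: mxop _ _).
exact: splitting_point_unique (xgetPex 0 (ex_intro _ x h)) h.
Qed.

Context (SM : S^T = - M).

(** On vectors of zero sum the centering matrix is the identity; it is symmetric
    and factors as [P *m M], hence also as [M^T *m P^T = - S *m P^T]. *)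
Lemma range_S (w : hpow H n) :
  (forall v : 'cV[R]_n, M *m v = 0 -> exists a : R, v = a *: const_mx 1) ->
  \sum_i w i = 0 -> exists z, mxop S z = w.
Proof.
move=> kerM w0.
have [P PE] := factor_through kerM (@centering_const1 R n).
have SE : S = - M^T by rewrite -[S]trmxK SM linearN.
exists (- mxop P^T w); rewrite SE mxopNl mxopNr opprK -mxopM -trmx_mul -PE.
by apply/ffunP => i; rewrite tr_centering mxop_centering w0 scaler0 subr0.
Qed.

(** [<x, S z>] is [- <M x, z>], and [<x, N x - x>] is half the quadratic form of
    [N + N^T - 2 Id], which equals [- C^T C - M^T M]. *)
Lemma residual_energy p (C : 'M[R]_(p, n)) z x :
  M^T *m M + N + N^T - 2%:M = - (C^T *m C) ->
  inner x (splitting_residual z x) =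
  - inner (mxop M x) z - (`|mxop C x| ^+ 2 + `|mxop M x| ^+ 2) / 2.
Proof.
move=> CE; rewrite /splitting_residual innerBr innerDr.
rewrite [inner x (mxop S z)]innerC mxop_adjoint SM mxopNl innerNr innerC.
have NT : inner x (mxop N^T x) = inner x (mxop N x).
  by rewrite -mxop_adjoint innerC.
have /(congr1 (fun A => inner x (mxop A x))) := CE.
rewrite !mxopDl !mxopNl !mxopM mxop_scalar !innerDr !innerNr innerZr NT.
rewrite -!mxop_adjoint !inner_normE; lra.
Qed.

End SplittingPoints.

(** * Consequences of the matrix inequality *)

Section Certificate.
Context (R : realType).

Lemma gram_quad p n (W : 'M[R]_(p, n)) (v : 'cV[R]_n) :
  (v^T *m (W^T *m W) *m v) 0 0 = \sum_i (W *m v) i 0 ^+ 2.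
Proof.
rewrite mulmxA -trmx_mul -mulmxA mxE; apply: eq_bigr => i _.
by rewrite mxE expr2.
Qed.

(** The quadratic form of [M^T M + C^T C = 2 Id - N - N^T] at [(1, ..., 1)] is
    [2 n - n - n = 0], so both of its nonnegative parts vanish there. *)
Lemma splitting_certificate m n (M : 'M[R]_(m, n)) (N : 'M[R]_n) :
  \sum_i \sum_j N i j = n%:R ->
  negative_semidefinite (M^T *m M + N + N^T - 2%:M) ->
  exists C : 'M[R]_n, [/\ M^T *m M + N + N^T - 2%:M = - (C^T *m C),
    M *m (const_mx 1 : 'cV_n) = 0 & C *m (const_mx 1 : 'cV_n) = 0].
Proof.
move=> sumN [symB negB]; set B := _ - _ in symB negB.
have [| |C CE] := @psd_factor R n (- B).
- by rewrite linearN/= symB.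
- by move=> v; rewrite mulmxN mulNmx mxE oppr_ge0.
exists C; rewrite -CE opprK; set e : 'cV[R]_n := const_mx 1.
have eNe : (e^T *m N *m e) 0 0 = n%:R.
  rewrite -mulmxA mxE -sumN; apply: eq_bigr => i _.
  by rewrite mulmx_const1 !mxE mul1r.
have e0 : \sum_i (M *m e) i 0 ^+ 2 + \sum_i (C *m e) i 0 ^+ 2 = 0.
  rewrite -!gram_quad -CE /B mulmxN mulNmx.
  rewrite !(mulmxDr, mulmxDl, mulmxN, mulNmx) mul_mx_scalar -scalemxAl.
  have eNTe : (e^T *m N^T *m e) 0 0 = n%:R.
    have -> : e^T *m N^T *m e = (e^T *m N *m e)^T by rewrite !trmx_mul trmxK mulmxA.
    by rewrite mxE.
  have ee : (e^T *m e) 0 0 = n%:R.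
    rewrite mxE; under eq_bigr do rewrite !mxE mulr1.
    by rewrite sumr_const card_ord.
  have addE (A A' : 'M[R]_1) : (A + A') 0 0 = A 0 0 + A' 0 0 by rewrite mxE.
  have oppE (A : 'M[R]_1) : (- A) 0 0 = - A 0 0 by rewrite mxE.
  have scaleE a (A : 'M[R]_1) : (a *: A) 0 0 = a * A 0 0 by rewrite mxE.
  by rewrite oppE !addE oppE scaleE eNe eNTe ee; lra.
have s0 p (W : 'M[R]_(p, n)) : 0 <= \sum_i (W *m e) i 0 ^+ 2.
  by apply: sumr_ge0 => i _; exact: sqr_ge0.
have W0 p (W : 'M[R]_(p, n)) : \sum_i (W *m e) i 0 ^+ 2 = 0 -> W *m e = 0.
  move=> W0; apply/colP => i; rewrite [RHS]mxE; apply/eqP; rewrite -sqrf_eq0.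
  by apply/eqP; apply: (psumr_eq0P _ W0) => // j _; exact: sqr_ge0.
have := s0 _ M; have := s0 _ C.
by split=> //; apply: W0; lra.
Qed.

End Certificate.

(** * Fejer inequality and demiclosedness *)

Section Splitting.
Context (R : realType) (H : hilbertType R) (m n : nat) (F : 'I_n -> H -> set H).
Context (M : 'M[R]_(m, n)) (S : 'M[R]_(n, m)) (N C : 'M[R]_n).
Context (Fmax : forall i, maximally_monotone (F i)).
Context (kerM : forall v : 'cV[R]_n, M *m v = 0 -> exists a : R, v = a *: const_mx 1).
Context (sumN : \sum_i \sum_j N i j = n%:R).
Context (SM : S^T = - M).
Context (CE : M^T *m M + N + N^T - 2%:M = - (C^T *m C)).
Context (Me : M *m (const_mx 1 : 'cV_n) = 0).
Context (Ce : C *m (const_mx 1 : 'cV_n) = 0).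

(** The columns of [S] have zero sum because [M] kills constants, and the
    contributions of [N] and of the identity are both [n *: xb]. *)
Lemma sum_residual_diag z (xb : H) :
  \sum_i splitting_residual S N z [ffun=> xb] i = 0.
Proof.
under eq_bigr do rewrite splitting_residualE mxop_diag [X in _ - X]ffunE.
rewrite sumrB big_split/= -scaler_suml sumN sumr_const card_ord scaler_nat.
rewrite addrK sum_mxop big1// => j _.
rewrite (_ : \sum_i S i j = - (M *m const_mx 1 : 'cV_m) j 0).
  by rewrite Me mxE oppr0 scale0r.
rewrite mulmx_const1 -sumrN; apply: eq_bigr => i _.
by move/matrixP: SM => /(_ j i); rewrite !mxE.
Qed.

(** If [u i] lies in [F i xb] and the [u i] sum to 0, it suffices to solve
    [S z = x + u - N x] for the diagonal [x]; the right-hand side has zero sum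
    since the entries of [N] sum to [n]. *)
Lemma zer_splitting_point xb : zer (sum_op F) xb ->
  exists z, splitting_point F S N z [ffun=> xb].
Proof.
move=> [u Fu u0]; pose w : hpow H n := [ffun=> xb] + finfun u - mxop N [ffun=> xb].
have wE i : w i = xb + u i - (\sum_j N i j) *: xb.
  by rewrite /w -mxop_diag !ffunE.
have [|z zE] := @range_S _ _ _ _ M S SM w kerM.
  under eq_bigr do rewrite wE.
  rewrite sumrB big_split/= -scaler_suml sumN sumr_const card_ord scaler_nat.
  by rewrite u0 addr0 subrr.
exists z; apply/splitting_pointP => i.
rewrite /splitting_residual zE /w subrK addrC addKr !ffunE; exact: Fu.
Qed.

(** Since [M x' = 0], monotonicity and [residual_energy] at [(z - z', x - x')]
    give [2 <M x, z - z'> <= - |M x|^2]; expand the square. *)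
Lemma fejer_step gamma z x z' x' : 0 < gamma ->
  splitting_point F S N z x -> splitting_point F S N z' x' -> mxop M x' = 0 ->
  `|z + gamma *: mxop M x - z'| ^+ 2 <=
  `|z - z'| ^+ 2 - gamma * (1 - gamma) * `|mxop M x| ^+ 2.
Proof.
move=> g0 /splitting_pointP h /splitting_pointP h' Mx'.
have := prod_op_monotone (fun i => (Fmax i).1) h h'.
rewrite splitting_residualB (residual_energy SM _ _ CE) mxopBr Mx' subr0.
rewrite addrAC normD_sqr normrZ exprMn real_normK ?num_real// innerZr.
rewrite (innerC (mxop M x)).
have := sqr_ge0 `|mxop C (x - x')|.
set d := inner _ _; set a := `|mxop M x| ^+ 2; set c := `|_| ^+ 2.
set q := `|z - z'| ^+ 2 => c0 dac.
have : 0 <= gamma * (- d - a / 2) by rewrite mulr_ge0 ?(ltW g0)//; lra.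
lra.
Qed.

(** By the energy identity [<x k, r k>] depends only on [M x], [C x], which tend
    strongly to 0, and on the bounded [z]: so it tends to 0, which is also
    [<xh, rh>] at the weak limit.  This lets
    [0 <= <x k - y, r k - v>] pass to the limit. *)
Lemma splitting_point_demiclosed (T : Type) (U : set_system T)
    {PU : ProperFilter U} (z : T -> hpow H m) (x : T -> hpow H n) c zh xh :
  (forall k, splitting_point F S N (z k) (x k)) -> (forall k, `|z k| <= c) ->
  mxop M (x k) @[k --> U] --> (0 : hpow H m) ->
  weak_limit U z zh -> weak_limit U x xh ->
  splitting_point F S N zh xh /\
  exists2 xb, zer (sum_op F) xb & xh = [ffun=> xb].
Proof.
move=> zx zc Mx0 zzh xxh.
have Mxh : mxop M xh = 0.
  exact: weak_limit_unique (weak_limit_mxop xxh) (cvg_weak_limit Mx0).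
have [xb xhE] := mxop_ker_diag kerM Mxh.
have Cx0 : mxop C (x k) @[k --> U] --> (0 : hpow H n).
  have [P ->] := factor_through kerM Ce.
  by under eq_cvg do rewrite mxopM; exact: mxop_cvg0.
pose r k := splitting_residual S N (z k) (x k).
pose rh := splitting_residual S N zh xh.
have rrh : weak_limit U r rh.
  move=> y; rewrite /r /rh /splitting_residual innerBl innerDl.
  under eq_cvg do rewrite innerBl innerDl.
  apply: cvgB (xxh y); apply: cvgD; exact: weak_limit_mxop.
have xr0 : inner (x k) (r k) @[k --> U] --> (0 : R).
  have -> : (0 : R) = - 0 - (`|0 : hpow H n| ^+ 2 + `|0 : hpow H m| ^+ 2) / 2.
    by rewrite !normr0 expr0n/= addr0 mul0r subr0 oppr0.
  under eq_cvg do rewrite (residual_energy SM _ _ CE).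
  have cvg_sqr_norm p (u : T -> hpow H p) l :
      u @ U --> l -> `|u k| ^+ 2 @[k --> U] --> `|l| ^+ 2.
    by move=> ul; rewrite expr2; apply: cvgM; exact: cvg_norm.
  apply: cvgB; first by apply: cvgN; exact: inner_cvg0 Mx0 zc.
  by apply: cvgMr_tmp; apply: cvgD; exact: cvg_sqr_norm.
have xhrh : inner xh rh = 0.
  rewrite (residual_energy SM _ _ CE) Mxh xhE (mxop_diag0 _ Ce) inner0l !normr0.
  by rewrite expr0n/= addr0 mul0r subr0 oppr0.
have Fxr : prod_op F xh rh.
  apply: prod_op_mem => // y v Fyv.
  have cv : inner (x k - y) (r k - v) @[k --> U] --> inner (xh - y) (rh - v).
    rewrite innerBl !(innerBr _ rh) xhrh.
    under eq_cvg => k do rewrite innerBl !(innerBr _ (r k)).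
    apply: cvgB; apply: cvgB => //.
    - rewrite innerC; under eq_cvg do rewrite innerC; exact: rrh.
    - exact: cvg_cst.
  rewrite -(cvg_lim _ cv)//.
  apply: limr_ge; first by apply/cvg_ex; eexists; exact: cv.
  apply: nearW => k; apply: (prod_op_monotone (fun i => (Fmax i).1)) => //.
  exact/splitting_pointP.
split; first exact/splitting_pointP.
exists xb => //; exists rh; last by rewrite /rh xhE sum_residual_diag.
by move=> i; have := Fxr i; rewrite xhE ffunE.
Qed.

End Splitting.

(** * Fejer monotone sequences *)

Section FejerSequences.
Context (R : realType).

Lemma descent_cvg (a b : nat -> R) (c : R) : 0 < c ->
  (forall k, 0 <= a k) -> (forall k, 0 <= b k) ->
  (forall k, a k.+1 <= a k - c * b k) -> cvgn a /\ b @ \oo --> (0 : R).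
Proof.
move=> c0 a0 b0 ab.
have acv : cvgn a.
  apply: nonincreasing_is_cvgn; last by exists 0 => _ [k _ <-].
  apply/nonincreasing_seqP => k; apply: le_trans (ab k) _.
  by rewrite gerBl mulr_ge0// ltW.
split=> //; apply: (@squeeze_cvgr _ _ _ _ (fun=> 0) (fun k => (a k - a k.+1) / c)).
- apply: nearW => k; rewrite b0/= ler_pdivlMr// mulrC.
  by have := ab k; lra.
- exact: cvg_cst.
- rewrite -(mul0r c^-1) -(subrr (limn a)); apply: cvgMr_tmp; apply: cvgB => //.
  by rewrite (cvg_shiftS a).
Qed.

(** [|u k - l'|^2 - |u k - l|^2] is affine in [<u k, l - l'>], so the latter
    converges; its limit is [<l, l - l'>] along [U] and [<l', l - l'>] along
    [U']. *)
Lemma opial (H : hilbertType R) (u : nat -> H) (l l' : H)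
    (U U' : set_system nat) {PU : ProperFilter U} {PU' : ProperFilter U'} :
  \oo `<=` U -> \oo `<=` U' -> weak_limit U u l -> weak_limit U' u l' ->
  cvgn (fun k => `|u k - l| ^+ 2) -> cvgn (fun k => `|u k - l'| ^+ 2) -> l = l'.
Proof.
move=> oU oU' ul ul' cl cl'.
have cd : cvgn (fun k => inner (u k) (l - l')).
  have -> : (fun k => inner (u k) (l - l')) = (fun k =>
      (`|u k - l'| ^+ 2 - `|u k - l| ^+ 2 + (`|l| ^+ 2 - `|l'| ^+ 2)) / 2).
    apply/funext => k; rewrite innerBr !normD_sqr !innerNr !normrN; lra.
  apply: is_cvgMr_tmp; apply: is_cvgD; last exact: is_cvg_cst.
  exact: is_cvgB.
have limE V y (PV : ProperFilter V) : \oo `<=` V -> weak_limit V u y ->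
    inner y (l - l') = limn (fun k => inner (u k) (l - l')).
  move=> oV uy; rewrite -(cvg_lim _ (uy (l - l')))//.
  apply: cvg_lim => // B /cd; exact: oV.
apply/eqP; rewrite -subr_eq0 -normr_eq0 -sqrf_eq0 -inner_normE innerBl.
by rewrite (limE U)// (limE U')// subrr.
Qed.

End FejerSequences.

(** * Convergence *)

Theorem theorem2p6 (R : realType) (H : hilbertType R) (m n : nat)
    (F : 'I_n -> H -> set H)
    (Fmax : forall i, maximally_monotone (F i))
    (Fzer : zer (sum_op F) !=set0)
    (M : 'M[R]_(m, n)) (S : 'M[R]_(n, m)) (N : 'M[R]_n)
    (kerM : forall v : 'cV[R]_n, M *m v = 0 -> exists a : R, v = a *: const_mx 1)
    (sumN : \sum_i \sum_j N i j = n%:R)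
    (trigN : forall i j : 'I_n, (i <= j)%N -> N i j = 0)
    (SM : S^T = - M)
    (MN : negative_semidefinite (M^T *m M + N + N^T - 2%:M))
    (gamma : R) (gamma01 : 0 < gamma < 1)
    (z : nat -> hpow H m) (x : nat -> hpow H n)
    (zE : forall k, z k.+1 = splitting_op F M S N gamma (z k))
    (xE : forall k, splitting_point F S N (z k) (x k)) :
  [/\ (z k - z k.+1 @[k --> \oo] --> (0 : hpow H m)) /\
      (forall s : 'I_n -> R, \sum_i s i = 0 ->
        \sum_i s i *: x k i @[k --> \oo] --> (0 : H)),
      exists2 zbar : hpow H m,
        Fix (splitting_op F M S N gamma) zbar & weak_cvg z zbar
    & exists2 xbar : H,
        zer (sum_op F) xbar & weak_cvg x ([ffun=> xbar] : hpow H n)].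
Proof.
have [C [CE Me Ce]] := splitting_certificate sumN MN.
have Fmon i : monotone_op (F i) := (Fmax i).1.
have [g0 g1] := andP gamma01.
have zS k : z k.+1 = z k + gamma *: mxop M (x k).
  by rewrite zE (splitting_opE _ _ Fmon trigN (xE k)).
have descent z' xb : splitting_point F S N z' [ffun=> xb] ->
    cvgn (fun k => `|z k - z'| ^+ 2) /\
    `|mxop M (x k)| ^+ 2 @[k --> \oo] --> (0 : R).
  move=> h; apply: (@descent_cvg _ _ _ (gamma * (1 - gamma))) => [|k|k|k].
  - by rewrite mulr_gt0// subr_gt0.
  - exact: sqr_ge0.
  - exact: sqr_ge0.
  - by rewrite zS; exact: (fejer_step Fmax SM CE g0 (xE k) h (mxop_diag0 _ Me)).
have [xs xs0] := Fzer.
have [zs zsP] := zer_splitting_point kerM sumN SM xs0.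
have [zs_cvg Mx0sq] := descent _ _ zsP.
have Mx0 : mxop M (x k) @[k --> \oo] --> (0 : hpow H m).
  apply/cvgr0Pnorm_lt => e e0; have e2 : 0 < e ^+ 2 by rewrite exprn_gt0.
  apply: filterS (cvgr_lt 0 Mx0sq _ e2) => k /=.
  by rewrite ltr_sqr ?nnegrE ?(ltW e0).
have [cz czP] : exists c, forall k, `|z k| <= c.
  have [c cP] : exists c, forall k, `|z k - zs| ^+ 2 <= c.
    have [c [_ cP]] := cvg_seq_bounded zs_cvg; exists (c + 1) => k.
    apply: le_trans (ler_norm _) _; apply: cP => //; lra.
  exists (c + 1 + `|zs|) => k; rewrite -{1}(subrK zs (z k)).
  apply: le_trans (ler_normD _ _) _; rewrite lerD2r.
  have := cP k; have := normr_ge0 (z k - zs); set t := `|_|; nra.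
have [cx cxP] : exists c, forall k, `|x k| <= c.
  have [K K0 KP] := splitting_point_lipschitz S Fmon trigN.
  exists (K * (cz + `|zs|) + `|[ffun=> xs] : hpow H n|) => k.
  rewrite -{1}(subrK [ffun=> xs] (x k)).
  apply: le_trans (ler_normD _ _) _; rewrite lerD2r.
  apply: le_trans (KP _ _ _ _ (xE k) zsP) _; rewrite ler_wpM2l//.
  by apply: le_trans (ler_normB _ _) _; rewrite lerD2r.
have cluster U : UltraFilter U -> \oo `<=` U ->
    exists zh xb, [/\ weak_limit U z zh, weak_limit U x [ffun=> xb],
      splitting_point F S N zh [ffun=> xb] & zer (sum_op F) xb].
  move=> UU oU; have PU := @ultra_proper _ _ UU.
  have [zh zzh] := bounded_weak_limit UU czP.
  have [xh xxh] := bounded_weak_limit UU cxP.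
  have Mx0U : mxop M (x k) @[k --> U] --> (0 : hpow H m).
    by move=> B /Mx0; exact: oU.
  have [spz [xb xb0 xhE]] :=
    splitting_point_demiclosed Fmax kerM sumN SM CE Me Ce xE czP Mx0U zzh xxh.
  by exists zh, xb; rewrite -xhE.
have [U [UU oU]] := @ultraFilterLemma nat \oo _.
have PU := @ultra_proper _ _ UU.
have [zh [xb [zzh xxb spz xb0]]] := cluster U UU oU.
have cluster_unique V : UltraFilter V -> \oo `<=` V ->
    weak_limit V z zh /\ weak_limit V x ([ffun=> xb] : hpow H n).
  move=> UV oV; have PV := @ultra_proper _ _ UV.
  have [zh' [xb' [zzh' xxb' spz' _]]] := cluster V UV oV.
  have zhE : zh' = zh.
    apply: (opial oV oU zzh' zzh); first by have [] := descent _ _ spz'.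
    by have [] := descent _ _ spz.
  rewrite zhE in zzh' spz'.
  by rewrite (splitting_point_unique Fmon trigN spz spz').
split.
- split.
    have -> : (fun k => z k - z k.+1) = (fun k => - gamma *: mxop M (x k)).
      by apply/funext => k; rewrite zS opprD addNKr scaleNr.
    have -> : (0 : hpow H m) = - gamma *: (0 : hpow H m) by rewrite scaler0.
    exact: cvgZl_tmp.
  move=> s s0; have [P PE] : exists P, \row_i s i = P *m M.
    apply: factor_through kerM _; apply/rowP => i; rewrite ord1 mulmx_const1 mxE.
    by under eq_bigr do rewrite mxE.
  have P0 : mxop P (mxop M (x k)) @[k --> \oo] --> (0 : hpow H 1).
    exact: mxop_cvg0.
  apply/norm_cvg0P.
  apply: (@squeeze_cvgr _ _ _ _ (fun=> 0) (fun k => `|mxop P (mxop M (x k))|)).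
  + apply: nearW => k; rewrite normr_ge0/= -mxopM -PE.
    apply: le_trans (hpow_norm_ge_comp _ ord0); rewrite mxopE.
    by under [in leRHS]eq_bigr do rewrite mxE.
  + exact: cvg_cst.
  + by rewrite -(normr0 (hpow H 1)); apply: cvg_norm.
- exists zh.
    by rewrite /Fix/= (splitting_opE _ _ Fmon trigN spz) (mxop_diag0 _ Me) scaler0 addr0.
  by apply: weak_limit_ultra => V UV oV; have [] := cluster_unique V UV oV.
- exists xb => //.
  by apply: weak_limit_ultra => V UV oV; have [] := cluster_unique V UV oV.
Qed.
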